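(* Let $m$ and $n$ be natural numbers. Then the lattice $\mathsf{B}(m,n)$ embeds (as a lattice) into some permutohedron $\mathsf{P}(\ell)$ ($\ell$ a positive integer) if and only if either $m\le2$ or $n\le2$.
   Context: For natural numbers $m,n$ (possibly zero), $\mathsf{B}(m,n)$ is the lattice obtained by doubling the join of $m$ atoms in the Boolean lattice with $m+n$ atoms: take the finite Boolean lattice $B$ with atoms $\boldsymbol a_1,\dots,\boldsymbol a_m,\boldsymbol b_1,\dots,\boldsymbol b_n$, put $\boldsymbol a=\boldsymbol a_1\vee\dots\vee\boldsymbol a_m$, and let $\mathsf{B}(m,n)=B\cup\{\boldsymbol p\}$ with a new element $\boldsymbol p$, where the order extends that of $B$ and, for $x\in B$, $x<\boldsymbol p$ iff $x\le\boldsymbol a$, and $\boldsymbol p<x$ iff $\boldsymbol a<x$. Permutohedra: let $[\ell]=\{1,\dots,\ell\}$ and $\mathcal{I}_\ell=\{(i,j)\in[\ell]\times[\ell] : i<j\}$. A subset $\boldsymbol x\subseteq\mathcal{I}_\ell$ is closed if it is transitive as a binary relation, and clopen if both $\boldsymbol x$ and $\mathcal{I}_\ell\setminus\boldsymbol x$ are closed. The permutohedron $\mathsf{P}(\ell)$ is the set of all clopen subsets of $\mathcal{I}_\ell$, ordered by inclusion; it is a lattice. A lattice embedding is an injective map preserving binary meets and joins (it need not preserve the bounds). *)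

(* Defs.v *)
From HB Require Import structures.
From mathcomp Require Import all_boot all_order.

Set Implicit Arguments.
Unset Strict Implicit.
Unset Printing Implicit Defensive.

Import Order.TTheory.

(* Preservation of possible bounds is not required. *)
Definition lattice_embeds d (L : latticeType d) d' (L' : latticeType d') : Prop :=
  exists f : L -> L',
    [/\ injective f, Order.meet_morphism f & Order.join_morphism f].

Section DoubledBoolean.
Variables m n : nat.

(* [inl i] stands for the atom a_i, [inr j] for the atom b_j; a subset of     *)
(* the atoms stands for its join in the Boolean lattice.                      *)
Local Notation atom := ('I_m + 'I_n)%type.

Definition bool_a : {set atom} := [set inl i | i : 'I_m].

(* [Some X] is the element X of the Boolean lattice, [None] the new element p. *)
Definition doubled_bool : Type := option {set atom}.
HB.instance Definition _ := Finite.on doubled_bool.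

Definition db_le (x y : doubled_bool) : bool :=
  match x, y with
  | Some X, Some Y => X \subset Y
  | Some X, None   => X \subset bool_a
  | None,   Some Y => bool_a \proper Y
  | None,   None   => true
  end.

Fact db_le_refl : reflexive db_le.
Proof. by case=> [X|] /=. Qed.

Fact db_le_anti : antisymmetric db_le.
Proof.
case=> [X|] [Y|] //=.
- by move=> /andP[XY YX]; congr Some; apply/eqP; rewrite eqEsubset XY.
- by move=> /andP[Xa] /proper_subn; rewrite Xa.
- by move=> /andP[] /proper_subn aY Ya; rewrite Ya in aY.
Qed.

Fact db_le_trans : transitive db_le.
Proof.
case=> [Y|] [X|] [Z|] //=.
- exact: subset_trans.
- exact: subset_trans.
- exact: proper_sub_trans.
- by move=> Xa /proper_sub; apply: subset_trans.
Qed.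

Definition db_meet (x y : doubled_bool) : doubled_bool :=
  match x, y with
  | Some X, Some Y =>
      if [&& bool_a \proper X, bool_a \proper Y & X :&: Y == bool_a]
      then None else Some (X :&: Y)
  | Some X, None => if bool_a \proper X then None else Some (X :&: bool_a)
  | None, Some Y => if bool_a \proper Y then None else Some (bool_a :&: Y)
  | None, None => None
  end.

Definition db_join (x y : doubled_bool) : doubled_bool :=
  match x, y with
  | Some X, Some Y => Some (X :|: Y)
  | Some X, None => if X \subset bool_a then None else Some (X :|: bool_a)
  | None, Some Y => if Y \subset bool_a then None else Some (bool_a :|: Y)
  | None, None => None
  end.

Fact db_lexI x y z : db_le x (db_meet y z) = db_le x y && db_le x z.
Proof.
case: y z => [Y|] [Z|] /=.
- case: ifP => [/and3P[aY aZ /eqP YZ]|H].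
    by case: x => [X|] /=; rewrite ?aY ?aZ // -subsetI YZ.
  case: x => [X|] /=; first exact: subsetI.
  rewrite !properEneq subsetI; move: H; rewrite !properEneq.
  case: (eqVneq bool_a Y) => [<-|aY] /=.
    case: (boolP (bool_a \subset Z)) => aZ; last by rewrite !andbF.
    by rewrite (setIidPl aZ) eqxx.
  case: (eqVneq bool_a Z) => [<-|aZ] /=.
    case: (boolP (bool_a \subset Y)) => aY'; last by rewrite !andbF.
    by rewrite (setIidPr aY') eqxx.
  case: (bool_a \subset Y); last by rewrite !andbF.
  case: (bool_a \subset Z); last by rewrite !andbF.
  by rewrite /= eq_sym => ->.
- case: ifP => aY; case: x => [X|] //=; rewrite ?subsetI ?aY //=.
    case: (boolP (X \subset bool_a)) => Xa; rewrite ?andbF // andbT.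
    by rewrite (subset_trans Xa) // proper_sub.
  by rewrite properEneq subsetI subxx andbT andbC; case: (eqVneq bool_a _);
     rewrite ?andbF // andbT; apply: contraNF => aY'; rewrite (setIidPr aY').
- case: ifP => aZ; case: x => [X|] //=; rewrite ?subsetI ?aZ //=.
    case: (boolP (X \subset bool_a)) => Xa //=.
    by rewrite (subset_trans Xa) // proper_sub.
  by rewrite properEneq subsetI subxx /= andbC; case: (eqVneq bool_a _);
     rewrite ?andbF // andbT; apply: contraNF => aZ'; rewrite (setIidPl aZ').
- by rewrite andbb.
Qed.

Fact db_leUx x y z : db_le (db_join x y) z = db_le x z && db_le y z.
Proof.
case: x y z => [X|] [Y|] [Z|] //=; rewrite ?subUset ?andbT ?andbb //.
- case: ifP => Xa /=.
    case: (boolP (bool_a \proper Z)) => aZ; last by rewrite andbF.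
    by rewrite (subset_trans Xa) // proper_sub.
  rewrite subUset properEneq; case: (eqVneq bool_a Z) => [<-|//].
  by rewrite Xa.
- by case: ifP => //= Xa; rewrite subUset Xa.
- case: ifP => Ya /=.
    case: (boolP (bool_a \proper Z)) => aZ //=.
    by rewrite (subset_trans Ya) // proper_sub.
  rewrite subUset properEneq; case: (eqVneq bool_a Z) => [<-|//].
  by rewrite Ya andbF.
- by case: ifP => //= Ya; rewrite subUset Ya andbF.
Qed.

Fact doubled_bool_display : Order.disp_t. Proof. by []. Qed.

HB.instance Definition _ := Order.Le_isPOrder.Build doubled_bool_display
  doubled_bool db_le_refl db_le_anti db_le_trans.
HB.instance Definition _ := Order.POrder_MeetJoin_isLattice.Build
  doubled_bool_display doubled_bool db_lexI db_leUx.

End DoubledBoolean.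

Section Permutohedron.
Variable l : nat.
Implicit Types (x y z : {set 'I_l * 'I_l}) (i j k : 'I_l).

(* [l] is represented by 'I_l, i.e. with its elements shifted down by one. *)
Definition increasing_pairs : {set 'I_l * 'I_l} := [set p : 'I_l * 'I_l | p.1 < p.2].

Definition closed_pairs x : bool :=
  [forall i, forall j, forall k,
    ((i, j) \in x) && ((j, k) \in x) ==> ((i, k) \in x)].

Lemma closed_pairsP x :
  reflect (transitive [rel i j | (i, j) \in x]) (closed_pairs x).
Proof.
apply: (iffP idP) => [cx j i k /= xij xjk|tx].
  by have /forallP/(_ i)/forallP/(_ j)/forallP/(_ k) := cx; rewrite xij xjk.
apply/forallP=> i; apply/forallP=> j; apply/forallP=> k.
by apply/implyP=> /andP[]; apply: tx.
Qed.

Definition clopen_pairs x : bool :=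
  [&& x \subset increasing_pairs, closed_pairs x
    & closed_pairs (increasing_pairs :\: x)].

Record permutohedron : Type := Permutohedron {
  pairs_of :> {set 'I_l * 'I_l};
  _ : clopen_pairs pairs_of
}.
HB.instance Definition _ := [isSub for pairs_of].
HB.instance Definition _ := [Finite of permutohedron by <:].

Implicit Types u v w : permutohedron.

Definition perm_le u v : bool := pairs_of u \subset pairs_of v.

Fact perm_le_refl : reflexive perm_le.
Proof. by move=> u; apply: subxx. Qed.

Fact perm_le_anti : antisymmetric perm_le.
Proof. by move=> u v uv; apply/val_inj/eqP; rewrite eqEsubset. Qed.

Fact perm_le_trans : transitive perm_le.
Proof. by move=> v u w; apply: subset_trans. Qed.

(* The join is the transitive closure of the union. *)
Definition union_rel x y : rel 'I_l := [rel i j | (i, j) \in x :|: y].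

Definition tclosure x y : {set 'I_l * 'I_l} :=
  [set p in increasing_pairs | connect (union_rel x y) p.1 p.2].

Lemma tclosureE x y i j :
  ((i, j) \in tclosure x y) = (i < j) && connect (union_rel x y) i j.
Proof. by rewrite !inE. Qed.

Lemma clopenS x i j : clopen_pairs x -> (i, j) \in x -> i < j.
Proof. by case/and3P=> /subsetP sx _ _ /sx; rewrite inE. Qed.

Lemma clopen_split x i j k : clopen_pairs x ->
  (i, k) \in x -> i < j -> j < k -> ((i, j) \in x) || ((j, k) \in x).
Proof.
case/and3P=> _ _ /closed_pairsP cx xik ij jk; apply: contraLR xik.
rewrite negb_or => /andP[nij njk].
have : (i, k) \in increasing_pairs :\: x.
  by apply: (cx j); rewrite /= !inE /= ?nij ?njk ?ij ?jk.
by rewrite inE => /andP[].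
Qed.

Lemma tclosure_clopen x y :
  clopen_pairs x -> clopen_pairs y -> clopen_pairs (tclosure x y).
Proof.
move=> cx cy; apply/and3P; split.
- by apply/subsetP=> p; rewrite inE => /andP[].
- apply/closed_pairsP => j i k; rewrite /= !tclosureE.
  move=> /andP[ij cij] /andP[jk cjk].
  by rewrite (ltn_trans ij jk) (connect_trans cij cjk).
apply/closed_pairsP => j i k /=; rewrite !in_setD !tclosureE !inE /=.
move=> /andP[nij ij] /andP[njk jk]; rewrite ij /= in nij; rewrite jk /= in njk.
have ik := ltn_trans ij jk; rewrite ik /= andbT.
apply/negP=> /connectP[p pP def_k]; move: nij njk jk.
rewrite def_k; elim: p i ij pP {ik def_k} => [|v p IHp] i ij /=.
  by move=> _ _ _ ji; have := ltn_trans ij ji; rewrite ltnn.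
case/andP=> uiv pP nij njk jk.
case: (ltngtP j v) => jv.
- have /orP[uij|ujv] : union_rel x y i j || union_rel x y j v.
    move: uiv; rewrite /union_rel /= !inE => /orP[] xiv.
      by have /orP[->|->] := clopen_split cx xiv ij jv; rewrite ?orbT.
    by have /orP[->|->] := clopen_split cy xiv ij jv; rewrite ?orbT.
  + by rewrite (connect1 uij) in nij.
  + case/negP: njk; apply: connect_trans (connect1 ujv) _.
    by apply/connectP; exists p.
- apply: (IHp v) => //; apply: contra nij.
  exact: connect_trans (connect1 uiv).
- by move/val_inj: jv nij => ->; rewrite connect1.
Qed.

Lemma tclosure_subset x y z : clopen_pairs x -> clopen_pairs y ->
  clopen_pairs z -> (tclosure x y \subset z) = (x \subset z) && (y \subset z).
Proof.
move=> cx cy /and3P[_ /closed_pairsP cz _]; apply/idP/andP.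
  move=> sz; split; apply: subset_trans sz; apply/subsetP=> -[i j] xij.
    by rewrite tclosureE (clopenS cx xij) connect1 // /union_rel /= inE xij.
  by rewrite tclosureE (clopenS cy xij) connect1 // /union_rel /= inE xij orbT.
case=> xz yz; apply/subsetP=> -[i k]; rewrite tclosureE.
case/andP=> ik /connectP[p pP def_k].
suff [e|//] : i = k \/ (i, k) \in z by rewrite e ltnn in ik.
rewrite def_k; elim: p i pP {ik def_k} => [|v p IHp] i /=; first by left.
case/andP=> uiv /IHp Hv; right.
have ziv : (i, v) \in z.
  by move: uiv; rewrite /union_rel /= !inE => /orP[/(subsetP xz)|/(subsetP yz)].
by case: Hv => [<-//|]; apply: cz.
Qed.

Definition perm_join u v : permutohedron :=
  Permutohedron (tclosure_clopen (valP u) (valP v)).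

Lemma compl_clopen x :
  clopen_pairs x -> clopen_pairs (increasing_pairs :\: x).
Proof.
case/and3P=> sx cx cx'; apply/and3P; split=> //; first exact: subsetDl.
by rewrite setDDr setDv set0U (setIidPr sx).
Qed.

Definition perm_compl u : permutohedron :=
  Permutohedron (compl_clopen (valP u)).

(* Complementation reverses the order, hence turns joins into meets. *)
Definition perm_meet u v : permutohedron :=
  perm_compl (perm_join (perm_compl u) (perm_compl v)).

Lemma perm_complK : involutive perm_compl.
Proof.
move=> u; apply/val_inj => /=.
have /and3P[su _ _] := valP u.
by rewrite setDDr setDv set0U (setIidPr su).
Qed.

Lemma perm_le_compl u v : perm_le (perm_compl u) (perm_compl v) = perm_le v u.
Proof.
have H a b : perm_le a b -> perm_le (perm_compl b) (perm_compl a).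
  by move=> ab; apply: setDS.
by apply/idP/idP=> [/H|/H//]; rewrite !perm_complK.
Qed.

Fact perm_leUx u v w : perm_le (perm_join u v) w = perm_le u w && perm_le v w.
Proof. exact: tclosure_subset (valP u) (valP v) (valP w). Qed.

Fact perm_lexI u v w : perm_le u (perm_meet v w) = perm_le u v && perm_le u w.
Proof.
rewrite /perm_meet -{1}(perm_complK u) perm_le_compl perm_leUx.
by rewrite !perm_le_compl.
Qed.

Fact permutohedron_display : Order.disp_t. Proof. by []. Qed.

HB.instance Definition _ := Order.Le_isPOrder.Build permutohedron_display
  permutohedron perm_le_refl perm_le_anti perm_le_trans.
HB.instance Definition _ := Order.POrder_MeetJoin_isLattice.Build
  permutohedron_display permutohedron perm_lexI perm_leUx.

End Permutohedron.

(* Main.v *)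
Require Import Defs.
From mathcomp Require Import all_boot all_order.
From mathcomp Require Import zify.

(* Necessity.  Let f embed B(m,n) with m, n >= 3 into P(l).  A pair in
   f(p) \ f(a) determines a subset U of the points such that the projection g of
   f to the Cambrian lattice A_U still separates p from a.  In A_U meets are
   intersections, joins are transitive closures of unions, and (s, t) in x forces
   (s, k) in x if k is in U and (k, t) in x otherwise, for s < k < t.  Take
   (i, j) in g(p) \ g(a) of minimal length.  For each k, a chain witnessing
   p <= a \/ b_k must jump from a point s_k of U (or i) to a point t_k outside U
   (or j) by a step in g(b_k).  Let k0 maximize s_k and let z end the first
   step of a refinement of (i, s_k0) along a_1, ..., a_m.  If z < s_k for some
   other k, then (z, j) is in g(a \/ b_k) and in g(a \/ b_k0), hence in g(p),
   against minimality.  So, for k <> k0, either s_k = i or (i, s_k) lies below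
   one atom a_h.  Dually, for all k but one, t_k = j or (t_k, j) lies below one
   atom a_h'.  As n >= 3, some k has both properties, so (i, j) is in
   g(a_h \/ a_h' \/ b_k), whose meet with p lies below a as m >= 3: a
   contradiction.

   Sufficiency.  By duality (B(m,n) and B(n,m) are dual, and permutohedra are
   self-dual) it suffices to embed B(m,n) for m <= 2, which is done by labelling
   the pairs of points explicitly. *)

Set Implicit Arguments.
Unset Strict Implicit.
Unset Printing Implicit Defensive.

Import Order.TTheory.

(** * Projection of clopen sets to a Cambrian lattice *)

Section Polar.
Variables (l : nat) (U : pred 'I_l).
Implicit Types (x y : {set 'I_l * 'I_l}) (u v w : permutohedron l).
Implicit Types (s t k : 'I_l).

(* The pairs in the image of x under the projection of the permutohedron onto
   the Cambrian lattice A_U, realized inside x. *)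
Definition polar x : rel 'I_l := fun s t =>
  (s < t) && [forall s' : 'I_l, forall t' : 'I_l,
    [&& s <= s', s' < t', t' <= t, (s' == s) || ~~ U s' & (t' == t) || U t']
    ==> ((s', t') \in x)].

Lemma polarP x s t : reflect
  (s < t /\ forall s' t' : 'I_l, s <= s' -> s' < t' -> t' <= t ->
     (s' == s) || ~~ U s' -> (t' == t) || U t' -> (s', t') \in x)
  (polar x s t).
Proof.
apply: (iffP andP) => -[st H]; split=> //.
  move=> s' t' h1 h2 h3 h4 h5.
  by have /forallP/(_ s')/forallP/(_ t')/implyP := H; apply; apply/and5P.
by apply/forallP=> s'; apply/forallP=> t'; apply/implyP=> /and5P[]; apply: H.
Qed.

Lemma polar_lt x s t : polar x s t -> s < t.
Proof. by case/andP. Qed.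

Lemma polar_mem x s t : polar x s t -> (s, t) \in x.
Proof. by case/polarP=> st; apply; rewrite ?eqxx. Qed.

(** A pair between [s] and [t] lies on one side of [k] or crosses it, and then it is composed of two
    pairs meeting at [k]. *)
Lemma polar_trans x : closed_pairs x -> transitive (polar x).
Proof.
move=> /closed_pairsP cx k s t /polarP[sk Hsk] /polarP[kt Hkt].
apply/polarP; split=> [|s' t' ss' st' tt' Us' Ut']; first exact: ltn_trans kt.
have [t'k|kt'] := leqP t' k.
  apply: Hsk => //; case/orP: Ut' => [/eqP e|->]; last by rewrite orbT.
  by move: t'k; rewrite e leqNgt kt.
have [ks'|s'k] := leqP k s'.
  apply: Hkt; rewrite // ?(ltnW kt') //.
  case/orP: Us' => [/eqP e|->]; last by rewrite orbT.
  by move: ks'; rewrite e leqNgt sk.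
by apply: (cx k) => /=; [apply: Hsk|apply: Hkt]; rewrite ?eqxx.
Qed.

Lemma polar_left x s k t : polar x s t -> s < k -> k < t -> U k -> polar x s k.
Proof.
move=> /polarP[st H] sk kt Uk; apply/polarP; split=> // s' t' h1 h2 h3 h4 h5.
apply: H => //; first exact: leq_trans h3 (ltnW kt).
by case/orP: h5 => [/eqP->|->]; rewrite ?Uk orbT.
Qed.

Lemma polar_right x s k t :
  polar x s t -> s < k -> k < t -> ~~ U k -> polar x k t.
Proof.
move=> /polarP[st H] sk kt Uk; apply/polarP; split=> // s' t' h1 h2 h3 h4 h5.
apply: H => //; first exact: leq_trans (ltnW sk) h1.
by case/orP: h4 => [/eqP->|->]; rewrite ?Uk orbT.
Qed.

Lemma union_path_lt u v s p :
  path (union_rel u v) s p -> p != [::] -> s < last s p.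
Proof.
elim: p s => [//|z p IHp] s /= /andP[sz zp] _.
have {}sz : s < z.
  by move: sz; rewrite /union_rel /= inE => /orP[]; apply: clopenS (valP _).
by case: p zp IHp => [//|q p] zp /(_ z zp isT); apply: ltn_trans.
Qed.

(** A pair missing from the meet is spanned by a chain of pairs each missing from [u] or [v]. The
    step by which the chain first reaches [U] or its end starts at [s] or outside [U], so it lies in
    both [u] and [v]. *)
Lemma polar_meet u v s t :
  polar (Order.meet u v) s t = polar u s t && polar v s t.
Proof.
apply/idP/andP => [/polarP[st H]|[/polarP[st Hu] /polarP[_ Hv]]].
  have le w : (Order.meet u v <= w)%O -> polar w s t.
    move=> /subsetP sub; apply/polarP; split=> // *; exact/sub/H.
  by split; apply: le; rewrite ?leIl ?leIr.
apply/polarP; split=> // s' t' ss' st' tt' Us' Ut'.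
rewrite /= !inE /= st' /= andbT.
apply/negP=> /connectP[p pP def_t'].
have {pP} : path (union_rel (perm_compl u) (perm_compl v)) s' p by [].
have p0 : p != [::].
  by case: p def_t' => // e; rewrite e ltnn in st'.
have : (s' == s) || ~~ U s' by [].
have : s <= s' by [].
have : last s' p = t' by [].
elim: p s' {ss' st' Us' def_t'} p0 => [//|z p IHp] s' _ /= zt' ss' Us'.
case/andP=> e pP.
have s'z : s' < z.
  by apply: (@union_path_lt (perm_compl u) (perm_compl v) s' [:: z]); rewrite //= e.
have zt : z <= t'.
  rewrite -zt'; case: (p) pP => // q p' pP.
  exact: ltnW (@union_path_lt (perm_compl u) (perm_compl v) _ _ pP isT).
have [Uz|nUz] := boolP ((z == t') || U z).
  have uvz : (z == t) || U z.
    by case/orP: Uz => [/eqP->|->]; rewrite ?Ut' ?orbT.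
  have inu : (s', z) \in pairs_of u by apply: Hu => //; apply: leq_trans tt'.
  have inv : (s', z) \in pairs_of v by apply: Hv => //; apply: leq_trans tt'.
  by move: e; rewrite /union_rel /= !inE inu inv.
rewrite negb_or in nUz; case/andP: nUz => nz nUz.
apply: (IHp z) => //.
- by apply: contraNneq nz => p0; rewrite -zt' p0.
- exact: leq_trans (ltnW s'z).
- by rewrite nUz orbT.
Qed.

(** By induction on [t - s], it suffices to treat a pair that no intermediate [k] splits within
    [polar w]. Such a pair lies in [polar u] or [polar v] itself. *)
Lemma polar_join u v s t :
  polar (Order.join u v) s t -> connect (relU (polar u) (polar v)) s t.
Proof.
have [d] := ubnP (t - s); elim: d s t => // d IHd s t lt_d pw.
pose w := Order.join u v.
have st := polar_lt pw.
have [/existsP[k /andP[sk kt]]|nsplit] :=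
    boolP [exists k, polar w s k && polar w k t].
  have sk' := polar_lt sk; have kt' := polar_lt kt.
  by apply: (@connect_trans _ _ k); apply: IHd => //; lia.
have cw := valP w.
have /polarP[_ Hst] := pw.
(* If [(k, t)] were in [w], it would be polar and [k] would split the pair: for a later [t'] in [U],
   induction keeps [(t', t)] out of [w], which forces [(k, t')] into [w]. *)
have HU k : s < k -> k < t -> U k -> (k, t) \notin pairs_of w.
  have [c] := ubnP (t - k); elim: c k => // c IHc k lt_c sk kt Uk.
  apply/negP=> ktw.
  case/negP: nsplit; apply/existsP; exists k.
  rewrite (polar_left pw) //=; apply/polarP; split=> // s' t' h1 h2 h3 h4 h5.
  case: (eqVneq s' k) h4 => [->|_] /= Us'; last first.
    by apply: Hst; rewrite ?Us' ?orbT //; apply: leq_trans h1; apply: ltnW.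
  case: (eqVneq t' t) h5 => [->//|ne] /= Ut'.
  have kt' : k < t' by apply: leq_ltn_trans h2.
  have t't : t' < t by rewrite ltn_neqAle ne.
  have /orP[//|t'tw] := clopen_split cw ktw kt' t't.
  have lt_c' : t - t' < c by lia.
  by have := IHc t' lt_c' (ltn_trans sk kt') t't Ut'; rewrite t'tw.
have HN k : s < k -> k < t -> ~~ U k -> (s, k) \notin pairs_of w.
  have [c] := ubnP (k - s); elim: c k => // c IHc k lt_c sk kt Uk.
  apply/negP=> skw.
  case/negP: nsplit; apply/existsP; exists k.
  rewrite (polar_right pw) // andbT; apply/polarP; split=> // s' t' h1 h2 h3 h4 h5.
  case: (eqVneq t' k) h5 => [->|_] /= Ut'; last first.
    by apply: Hst; rewrite ?Ut' ?orbT //; apply: leq_trans h3 (ltnW _).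
  case: (eqVneq s' s) h4 => [->//|ne] /= Us'.
  have s'k : s' < k by apply: leq_trans h3.
  have ss' : s < s' by rewrite ltn_neqAle eq_sym ne.
  have /orP[s'sw|//] := clopen_split cw skw ss' s'k.
  have lt_c' : s' - s < c by lia.
  by have := IHc s' lt_c' ss' (ltn_trans s'k kt) Us'; rewrite s'sw.
(* The first step of a chain for [(s, t)] must reach [t]: an intermediate end [z] contradicts [HU]
   or [HN]. *)
have stx : ((s, t) \in pairs_of u) || ((s, t) \in pairs_of v).
  have := polar_mem pw.
  rewrite /= tclosureE => /andP[_ /connectP[[|z p] /= pP def_t]].
    by rewrite def_t ltnn in st.
  case/andP: pP => sz pP.
  have sz' : s < z.
    by apply: (@union_path_lt u v s [:: z]); rewrite //= sz.
  case: (eqVneq p [::]) => [p0|p0].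
    by move: sz; rewrite def_t p0 /union_rel /= inE.
  have zt : z < t by rewrite def_t; apply: union_path_lt pP p0.
  case: (boolP (U z)) => [/(HU _ sz' zt)|/(HN _ sz' zt)]; rewrite tclosureE.
    by rewrite zt; case/connectP; exists p.
  by rewrite sz' connect1.
have main x : clopen_pairs x -> x \subset pairs_of w -> (s, t) \in x ->
    polar x s t.
  move=> cx /subsetP xw xst; apply/polarP; split=> // s' t' h1 h2 h3 h4 h5.
  have xs't : (s', t) \in x.
    case: (eqVneq s' s) h4 => [->//|ne] /= Us'.
    have ss' : s < s' by rewrite ltn_neqAle eq_sym ne.
    have s't : s' < t by apply: leq_trans h3.
    have /orP[/xw|//] := clopen_split cx xst ss' s't.
    by rewrite (negPf (HN _ ss' s't Us')).
  case: (eqVneq t' t) h5 => [->//|ne] /= Ut'.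
  have t't : t' < t by rewrite ltn_neqAle ne.
  have /orP[//|/xw] := clopen_split cx xs't h2 t't.
  by rewrite (negPf (HU _ (leq_ltn_trans h1 h2) t't Ut')).
apply: connect1; rewrite /=.
case/orP: stx => stx; apply/orP; [left|right]; apply: main => //.
- exact: (valP u).
- exact: (leUl u v).
- exact: (valP v).
- exact: (leUr v u).
Qed.

End Polar.

(** * First steps and switching points of chains *)

Lemma connect_first (T : finType) (e : rel T) i t :
  connect e i t -> i != t -> exists2 z, e i z & connect e z t.
Proof.
case/connectP=> [[|z p]] /= pP ->; first by rewrite eqxx.
by case/andP: pP => iz pP _; exists z => //; apply/connectP; exists p.
Qed.

Lemma connect_switch (T : finType) (e : rel T) (P : pred T) i j :
    connect e i j -> P i -> ~~ P j ->
  exists x y, [/\ P x, ~~ P y, e x y, connect e i x & connect e y j].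
Proof.
case/connectP=> p; elim: p i => [|z p IHp] i /= pP def_j Pi nPj.
  by rewrite def_j Pi in nPj.
case/andP: pP => iz pP.
have [Pz|nPz] := boolP (P z); last first.
  by exists i, z; split=> //; apply/connectP; exists p.
have [x [y [Px Py xy zx yj]]] := IHp z pP def_j Pz nPj.
by exists x, y; split=> //; apply: connect_trans (connect1 iz) zx.
Qed.

(** * Axiomatic form of the projected family of relations *)

Section Polarized.
Variables (m n : nat) (T : finType).
Local Notation L := (doubled_bool m n).
Local Notation atom := ('I_m + 'I_n)%type.
Local Notation base := (bool_a m n).
Local Notation elt := (Some : {set atom} -> L).
Local Notation new := (None : L).

(** These are the properties of the projection that the argument uses. The order enters through a
    rank [r] so that reversing it gives another instance. *)
Record polarized (r : T -> nat) (U : pred T) (g : L -> rel T) : Prop :=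
  Polarized {
    rank_inj : injective r;
    polar_rank : forall x s t, g x s t -> r s < r t;
    polarized_trans : forall x, transitive (g x);
    polarized_meet : forall x y s t, g (Order.meet x y) s t = g x s t && g y s t;
    polarized_join : forall x y s t,
      g (Order.join x y) s t -> connect (relU (g x) (g y)) s t;
    polarized_left : forall x s k t,
      g x s t -> r s < r k -> r k < r t -> U k -> g x s k;
    polarized_right : forall x s k t,
      g x s t -> r s < r k -> r k < r t -> ~~ U k -> g x k t }.

(** Reversal exchanges [polarized_left] and [polarized_right]; it lets [left_parts] serve for the
    right ends too. *)
Lemma polarized_rev r r' U g :
    injective r' -> (forall s t, (r' s < r' t) = (r t < r s)) ->
  polarized r U g -> polarized r' (predC U) (fun x s t => g x t s).
Proof.
move=> r'I r'E [rI gr gt gI gU gl gR]; split=> //.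
- by move=> x s t /gr; rewrite r'E.
- by move=> x k s t /= ks tk; apply: gt ks.
- move=> x y s t /gU => [ts]; have := connect_rev (relU (g x) (g y)).
  move/(_ s t) => /= e; move: ts; rewrite -e.
  by congr (is_true _); apply: eq_connect.
- by move=> x s k t ts; rewrite !r'E => sk kt /= Uk; apply: (gR x t).
- by move=> x s k t ts; rewrite !r'E negbK => sk kt Uk; apply: (gl x t k s).
Qed.

Variables (r : T -> nat) (U : pred T) (g : L -> rel T).
Hypothesis gP : polarized r U g.

Lemma polarized_mono x y s t : (x <= y)%O -> g x s t -> g y s t.
Proof. by move=> /meet_l <-; rewrite (polarized_meet gP) => /andP[]. Qed.

Lemma polarized_connect x y s t :
  connect (relU (g x) (g y)) s t -> s = t \/ g (Order.join x y) s t.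
Proof.
case/connectP=> p; elim: p s => [|z p IHp] s /= pP; first by left.
case/andP: pP => sz pP /(IHp _ pP) zt; right.
have {}sz : g (Order.join x y) s z.
  case/orP: sz; apply: polarized_mono; [exact: leUl|exact: leUr].
by case: zt => [<-//|]; apply: polarized_trans gP _ _ _ _ sz.
Qed.

(* z is the first point of a chain from i to t each of whose steps lies below
   at most one atom of X. *)
Lemma polarized_first_atom (X : {set atom}) i t : g (elt X) i t ->
  exists (Y : {set atom}) z, [/\ Y \subset X, #|Y| <= 1, g (elt Y) i z
                & z = t \/ g (elt X) z t].
Proof.
have [d] := ubnP #|X|; elim: d X i t => // d IHd X i t ltXd git.
have [X1|X1] := leqP #|X| 1; first by exists X, t; split=> //; left.
have [c cX] : exists c, c \in X by apply/card_gt0P; apply: ltn_trans X1.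
have defX : Order.join (elt [set c]) (elt (X :\ c)) = elt X.
  by rewrite -[X in RHS](setD1K cX).
have it : i != t by apply: contraTneq (polar_rank gP git) => ->; rewrite ltnn.
move: git; rewrite -defX => /(polarized_join gP)/connect_first/(_ it)[z iz].
move/polarized_connect; rewrite defX => zt.
case/orP: iz => /= iz.
  by exists [set c], z; split; rewrite ?sub1set ?cards1.
have ltX'd : #|X :\ c| < d by move: ltXd; rewrite (cardsD1 c) cX.
have [Y [z' [YX Y1 iz' z'z]]] := IHd _ _ _ ltX'd iz.
have X'X : X :\ c \subset X by apply: subD1set.
exists Y, z'; split=> //; first exact: subset_trans YX X'X.
case: z'z => [->//|z'z]; right.
have {}z'z : g (elt X) z' z by apply: polarized_mono z'z.
by case: zt => [<-//|]; apply: polarized_trans gP _ _ _ _ z'z.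
Qed.

(** The doubling enters here: p lies below every element strictly above a, so these two meet in p
    and not in a. *)
Lemma meet_covers (k k' : 'I_n) : k != k' ->
  Order.meet (elt (base :|: [set inr k])) (elt (base :|: [set inr k'])) = new.
Proof.
move=> kk'; rewrite /Order.meet /= /db_meet.
have nin q : inr q \notin base by apply/imsetP => -[].
have prop q : base \proper base :|: [set inr q].
  rewrite properE subsetUl; apply/subsetPn; exists (inr q) => //.
  by rewrite !inE eqxx orbT.
rewrite !prop -setUIr (_ : [set inr k] :&: [set inr k'] = set0) ?setU0 ?eqxx //.
by apply/setP=> q; rewrite !inE; apply: contraNF kk' => /andP[/eqP->] /eqP[->].
Qed.

(** [s k] stands for the left end of the step below b_k in a chain from [i] to [j]. The bound on
    [#|Y|] later limits how many atoms of a are needed to join [i] to [j]. *)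
Lemma left_parts (i j : T) (s : 'I_n -> T) : 0 < n ->
    ~~ g (elt base) i j ->
    (forall z, r i < r z -> r z < r j -> g new z j -> g (elt base) z j) ->
    (forall z, r i < r z -> r z < r j -> U z -> g (elt base) i z) ->
    (forall z, r i < r z -> r z < r j -> ~~ U z -> g (elt base) z j) ->
    (forall k, s k = i \/ [/\ U (s k), r i < r (s k) & r (s k) < r j]) ->
    (forall k, g (elt (base :|: [set inr k])) (s k) j) ->
  exists k0, forall k, k != k0 ->
    s k = i \/
    exists Y : {set atom}, [/\ Y \subset base, #|Y| <= 1 & g (elt Y) i (s k)].
Proof.
move=> n0 nij minj gU gN sP sj.
pose k0 := [arg max_(k > Ordinal n0) r (s k)].
have k0max k : r (s k) <= r (s k0).
  by rewrite /k0; case: arg_maxnP => // k1 _; apply.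
exists k0 => k kk0.
case: (sP k) => [|[Uk ik kj]]; [by left|right].
case: (sP k0) => [e|[Uk0 ik0 k0j]].
  by have := k0max k; rewrite e leqNgt ik.
have gbase z : g (elt base) i z -> ~~ g (elt base) z j.
  move=> iz; apply: contra nij => zj; exact: polarized_trans gP _ _ _ _ iz zj.
have [Y [z [YX Y1 iz zk0]]] := polarized_first_atom (gU _ ik0 k0j Uk0).
have {}zk0 : r z <= r (s k0) /\ (z = s k0 \/ g (elt base) z (s k0)).
  by split=> //; case: zk0 => [->//|/(polar_rank gP)/ltnW].
case: zk0 => zlek0 zk0.
have zj : r z < r j := leq_ltn_trans zlek0 k0j.
have riz := polar_rank gP iz.
have izb : g (elt base) i z by apply: polarized_mono iz.
have Uz : U z.
  by apply: contraT => /(gN z riz zj) h; have := gbase z izb; rewrite h.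
(* Cutting [(i, z)] at [s k], a point of [U], keeps it below the same [Y]. *)
have [klez|zk] := leqP (r (s k)) (r z).
  exists Y; split=> //.
  move: klez; rewrite leq_eqVlt => /orP[/eqP/(rank_inj gP)->//|kz].
  exact: polarized_left gP _ _ _ _ iz ik kz Uk.
have {zk0} zk0 : g (elt base) z (s k0).
  by case: zk0 => // e; move: zk; rewrite e ltnNge k0max.
have cov q : (elt base <= elt (base :|: [set inr q]))%O by apply: subsetUl.
have zk' : g (elt base) z (s k).
  have := k0max k; rewrite leq_eqVlt => /orP[/eqP/(rank_inj gP)->//|kk].
  exact: polarized_left gP _ _ _ _ zk0 zk kk Uk.
(* [z] reaches [j] through [s k] and through [s k0], hence below two elements whose meet is p. *)
have zjn : g new z j.
  rewrite -(meet_covers kk0) (polarized_meet gP); apply/andP; split.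
    exact: polarized_trans gP _ _ _ _ (polarized_mono (cov _) zk') (sj k).
  exact: polarized_trans gP _ _ _ _ (polarized_mono (cov _) zk0) (sj k0).
by have := gbase z izb; rewrite (minj z riz zj zjn).
Qed.

End Polarized.

(** * Impossibility when m and n are at least 3 *)

Section NoEmbedding.
Variables (m n : nat).
Local Notation L := (doubled_bool m n).
Local Notation base := (bool_a m n).
Local Notation elt := (Some : {set 'I_m + 'I_n} -> L).
Local Notation new := (None : L).

Lemma card_bool_a : #|base| = m.
Proof. by rewrite card_imset ?card_ord // => i j []. Qed.

Lemma polarized_collapse (T : finType) (r r' : T -> nat) (U : pred T)
    (g : L -> rel T) i j :
    2 < m -> 2 < n ->
    injective r' -> (forall s t, (r' s < r' t) = (r t < r s)) ->
  polarized r U g -> g new i j -> g (elt base) i j.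
Proof.
move=> m2 n2 r'I r'E gP gij; apply: contraT => nij.
pose bad (p : T * T) := g new p.1 p.2 && ~~ g (elt base) p.1 p.2.
have bad0 : bad (i, j) by rewrite /bad gij.
case: (@arg_minnP _ (i, j) bad (fun p => r p.2 - r p.1) bad0) => -[i' j'].
rewrite /bad /= => {gij nij bad0 i j} /andP[gij nij] minij.
rename i' into i, j' into j.
have ij := polar_rank gP gij.
have minj z : r i < r z -> r z < r j -> g new z j -> g (elt base) z j.
  move=> iz zj gzj; apply: contraT => nzj.
  have /(_ (z, j)) /= := minij; rewrite gzj nzj => /(_ isT); lia.
have mini z : r i < r z -> r z < r j -> g new i z -> g (elt base) i z.
  move=> iz zj giz; apply: contraT => niz.
  have /(_ (i, z)) /= := minij; rewrite giz niz => /(_ isT); lia.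
have gU z : r i < r z -> r z < r j -> U z -> g (elt base) i z.
  by move=> iz zj Uz; apply: mini => //; apply: (polarized_left gP gij).
have gN z : r i < r z -> r z < r j -> ~~ U z -> g (elt base) z j.
  by move=> iz zj Uz; apply: minj => //; apply: (polarized_right gP gij).
have baseT z : g (elt base) i z -> g (elt base) z j -> False.
  by move=> iz zj; case/negP: nij; apply: polarized_trans gP _ _ _ _ iz zj.
have switch (k : 'I_n) : exists st : T * T,
  [/\ st.1 = i \/ [/\ U st.1, r i < r st.1 & r st.1 < r j],
      st.2 = j \/ [/\ ~~ U st.2, r i < r st.2 & r st.2 < r j]
    & g (elt [set inr k]) st.1 st.2].
  have : g (Order.join (elt base) (elt [set inr k])) i j.
    have leN : (new <= elt (base :|: [set inr k]))%O.
      rewrite /Order.le /= properE subsetUl; apply/subsetPn; exists (inr k).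
        by rewrite !inE eqxx orbT.
      by apply/imsetP => -[].
    exact: (polarized_mono gP leN gij).
  (* [j] may belong to [U]; excluding it makes every chain from [i] to [j] leave [P], at a point
     outside [U] or at [j] itself. *)
  pose P z := (z == i) || (U z && (z != j)).
  have nPj : ~~ P j.
    by rewrite /P eqxx andbF orbF; apply: contraTneq ij => ->; rewrite ltnn.
  have Pi : P i by rewrite /P eqxx.
  move/(polarized_join gP)/connect_switch => /(_ P Pi nPj).
  case=> x [y [Px nPy xy ix yj]].
  have rx : x = i \/ r i < r x.
    by case: (polarized_connect gP ix) => [->|/(polar_rank gP)]; [left|right].
  have ry : y = j \/ r y < r j.
    by case: (polarized_connect gP yj) => [->|/(polar_rank gP)]; [left|right].
  have rxy : r x < r y by case/orP: xy => /(polar_rank gP).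
  have xj : r x < r j by case: ry rxy => [->//|yj' xy']; apply: ltn_trans yj'.
  have iy : r i < r y by case: rx rxy => [->//|ix']; apply: ltn_trans.
  have x' : x = i \/ [/\ U x, r i < r x & r x < r j].
    case: rx => [|ix']; [by left|right; split=> //].
    by case/orP: Px => [/eqP e|/andP[]//]; move: ix'; rewrite e ltnn.
  have y' : y = j \/ [/\ ~~ U y, r i < r y & r y < r j].
    case: ry => [|yj']; [by left|right; split=> //].
    move: nPy; rewrite negb_or negb_and negbK => /andP[_ /orP[//|/eqP e]].
    by move: yj'; rewrite e ltnn.
  exists (x, y); split=> //=.
  (* If the switching step lay below a, then [gU] and [gN] would extend it to [(i, j)] below a. *)
  case/orP: xy => // /= xy; exfalso.
  case: x' => [e|[Ux ix' xj']]; case: y' => [e'|[Uy iy' yj']].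
  - by case/negP: nij; rewrite -e -e'.
  - by apply: (baseT y); [rewrite -e|apply: gN].
  - by apply: (baseT x); [apply: gU|rewrite -e'].
  - apply: (baseT x); first exact: gU.
    by exact: (polarized_trans gP xy (gN _ _ _ _)).
have /fin_all_exists[st stP] := switch.
have n0 : 0 < n by apply: leq_trans n2.
have bcov k : (elt [set inr k] <= elt (base :|: [set inr k]))%O.
  exact: subsetUr.
have acov k : (elt base <= elt (base :|: [set inr k]))%O.
  exact: subsetUl.
have [k1 k1P] : exists k0, forall k, k != k0 -> (st k).1 = i \/
    exists Y : {set _}, [/\ Y \subset base, #|Y| <= 1 & g (elt Y) i (st k).1].
  apply: (left_parts gP (j := j)) => //.
    by move=> k; have [] := stP k.
  move=> k; have [_ tk /(polarized_mono gP (bcov k)) stk] := stP k.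
  case: tk => [<-//|[Uk ik kj]].
  apply: (polarized_trans gP stk).
  by apply: (polarized_mono gP (acov k)); apply: gN.
have gP' := polarized_rev r'I r'E gP.
have [k2 k2P] : exists k0, forall k, k != k0 -> (st k).2 = j \/
    exists Y : {set _}, [/\ Y \subset base, #|Y| <= 1 & g (elt Y) (st k).2 j].
  apply: (left_parts gP' (j := i)) => //=.
  - by move=> z; rewrite !r'E => *; apply: mini.
  - by move=> z; rewrite !r'E => *; apply: gN.
  - by move=> z; rewrite !r'E negbK => *; apply: gU.
  - by move=> k; have [_ [->|[? ? ?]] _] := stP k; rewrite !r'E; [left|right].
  move=> k; have [sk _ /(polarized_mono gP (bcov k)) stk] := stP k.
  case: sk => [<-//|[Uk ik kj]].
  apply: (polarized_trans gP _ stk).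
  by apply: (polarized_mono gP (acov k)); apply: gU.
(* Each side excludes at most one index, and there are at least three. *)
have [k kk] : exists k, k \notin [set k1; k2].
  have : 0 < #|~: [set k1; k2]|.
    by have := cardsC [set k1; k2]; rewrite card_ord cards2; lia.
  by case/card_gt0P => k; rewrite inE; exists k.
move: kk; rewrite !inE negb_or => /andP[kk1 kk2].
have [_ _ stk] := stP k.
have left : exists Y : {set 'I_m + 'I_n},
    [/\ Y \subset base, #|Y| <= 1 & i = (st k).1 \/ g (elt Y) i (st k).1].
  case: (k1P k kk1) => [e|[Y [? ? ?]]]; last by exists Y; split=> //; right.
  by exists set0; rewrite sub0set cards0; split=> //; left.
have right : exists Y : {set 'I_m + 'I_n},
    [/\ Y \subset base, #|Y| <= 1 & (st k).2 = j \/ g (elt Y) (st k).2 j].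
  case: (k2P k kk2) => [e|[Y [? ? ?]]]; last by exists Y; split=> //; right.
  by exists set0; rewrite sub0set cards0; split=> //; left.
case: left => Y1 [Y1b Y1c Y1g]; case: right => Y2 [Y2b Y2c Y2g].
(* [X] joins [i] to [j] with at most two atoms of a, so it is not above p when m is at least 3. *)
pose X := Y1 :|: Y2 :|: [set inr k].
have Y1X : (elt Y1 <= elt X)%O.
  exact: (subset_trans (subsetUl Y1 Y2) (subsetUl _ _)).
have Y2X : (elt Y2 <= elt X)%O.
  exact: (subset_trans (subsetUr Y1 Y2) (subsetUl _ _)).
have kX : (elt [set inr k] <= elt X)%O by apply: subsetUr.
have gX : g (elt X) i j.
  have stX := polarized_mono gP kX stk.
  have {stX} sjX : g (elt X) (st k).1 j.
    case: Y2g => [<-//|/(polarized_mono gP Y2X)].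
    exact: polarized_trans gP _ _ _ _ stX.
  case: Y1g => [->//|/(polarized_mono gP Y1X) h].
  exact: polarized_trans gP _ _ _ _ h sjX.
have nprop : ~~ (base \proper X).
  apply/negP=> /proper_sub /subsetP bX.
  have sub : base \subset Y1 :|: Y2.
    apply/subsetP=> a ab; have := bX a ab; rewrite inE => /orP[//|].
    by rewrite inE => /eqP e; case/imsetP: ab => x _; rewrite e.
  have := subset_leq_card sub; rewrite card_bool_a leqNgt => /negP[].
  apply: leq_ltn_trans m2; apply: leq_trans (leq_add Y1c Y2c).
  exact: (leq_card_setU Y1 Y2).
have meetX : (Order.meet (elt X) new <= elt base)%O.
  by rewrite /Order.meet /= /db_meet (negPf nprop); apply: subsetIr.
have /(polarized_mono gP meetX) gijb : g (Order.meet (elt X) new) i j.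
  by rewrite (polarized_meet gP) gX.
by rewrite gijb in nij.
Qed.

Lemma no_embedding l : 2 < m -> 2 < n -> ~ lattice_embeds L (permutohedron l).
Proof.
move=> m2 n2 [f [fI fM fJ]].
have lef : (f (elt base) <= f new)%O.
  rewrite leEmeet -fM; apply/eqP; congr f.
  by rewrite /Order.meet /= /db_meet properxx setIid.
have nle : ~~ (pairs_of (f new) \subset pairs_of (f (elt base))).
  apply/negP=> le; suff /fI : f new = f (elt base) by [].
  by apply/le_anti/andP.
case/subsetPn: nle => -[i j] ijn ija.
pose bad (p : 'I_l * 'I_l) :=
  (p \in pairs_of (f new)) && (p \notin pairs_of (f (elt base))).
have bad0 : bad (i, j) by rewrite /bad ijn.
case: (@arg_minnP _ (i, j) bad (fun p => p.2 - p.1) bad0) => -[i' j'].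
rewrite /bad /= => {ijn ija bad0 i j} /andP[ijn ija] minij.
rename i' into i, j' into j.
have cn := valP (f new); have ca := valP (f (elt base)).
have ij := clopenS cn ijn.
have mem_a (s t : 'I_l) : (s, t) \in pairs_of (f new) -> t - s < j - i ->
    (s, t) \in pairs_of (f (elt base)).
  move=> stn; rewrite ltnNge; apply: contraNT => sta.
  by have /(_ (s, t)) := minij; rewrite stn sta; apply.
(* With this [U] the pair survives the projection: for [s] outside [U], clopenness applied to
   [(i, j)] gives [(s, j)], and applied to [(i, t)] with [t] in [U] it gives [(s, t)]. *)
pose U k := (i, k) \in pairs_of (f new).
have pn : polar U (pairs_of (f new)) i j.
  apply/polarP; split=> // s t h1 h2 h3 Us Ut.
  have sj : (s, j) \in pairs_of (f new).
    case: (eqVneq s i) Us => [->//|ne] /= Us.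
    have lis : i < s by rewrite ltn_neqAle eq_sym ne.
    have := clopen_split cn ijn lis (leq_trans h2 h3).
    by rewrite -/(U s) (negPf Us).
  case: (eqVneq t j) Ut => [->//|ne] /= Ut.
  case: (eqVneq s i) Us => [->//|ne'] /= Us.
  have lis : i < s by rewrite ltn_neqAle eq_sym ne'.
  have := clopen_split cn Ut lis h2.
  by rewrite -/(U s) (negPf Us).
have gP : polarized (@nat_of_ord l) U (fun x => polar U (pairs_of (f x))).
  split.
  - exact: val_inj.
  - by move=> x s t /polar_lt.
  - by move=> x; apply: polar_trans; case/and3P: (valP (f x)).
  - by move=> x y s t; rewrite fM polar_meet.
  - by move=> x y s t; rewrite fJ => /polar_join.
  - by move=> x s k t; apply: polar_left.
  - by move=> x s k t; apply: polar_right.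
have revE (s t : 'I_l) : (rev_ord s < rev_ord t) = (t < s).
  by rewrite /=; have := ltn_ord s; have := ltn_ord t; lia.
have revI : injective (fun s : 'I_l => nat_of_ord (rev_ord s)).
  by move=> s t /val_inj/rev_ord_inj.
have := polarized_collapse m2 n2 revI revE gP pn.
by move/polar_mem; rewrite (negPf ija).
Qed.

End NoEmbedding.

(** * Embedding when m is at most 2 *)

(** Sets with at most one element are join-prime, which is why the labels at the two ends respect
    joins. *)
Lemma subsetU_small (T : finType) (A X Y : {set T}) : #|A| <= 1 ->
  (A \subset X :|: Y) = (A \subset X) || (A \subset Y).
Proof.
rewrite leq_eqVlt ltnS leqn0 cards_eq0 => /orP[/cards1P[a ->]|/eqP->].
  by rewrite !sub1set inE.
by rewrite !sub0set.
Qed.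

Section Embedding.
Variables (m n : nat).
Hypothesis m2 : m <= 2.
Local Notation L := (doubled_bool m n).
Local Notation base := (bool_a m n).
Local Notation new := (None : L).
Implicit Types x y : L.

(** This is the lattice homomorphism onto the Boolean lattice that identifies p with a. *)
Definition support x : {set 'I_m + 'I_n} := odflt base x.

Lemma some_le X x : ((Some X : L) <= x)%O = (X \subset support x).
Proof. by case: x. Qed.

Lemma support_meet x y : support (Order.meet x y) = support x :&: support y.
Proof.
rewrite /Order.meet; case: x y => [X|] [Y|] /=.
- by case: ifP => //= /and3P[_ _ /eqP].
- by case: ifP => //= /proper_sub/setIidPr.
- by case: ifP => //= /proper_sub/setIidPl.
- by rewrite setIid.
Qed.

Lemma support_join x y : support (Order.join x y) = support x :|: support y.
Proof.
rewrite /Order.join; case: x y => [X|] [Y|] //=.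
- by case: ifP => //= /setUidPr.
- by case: ifP => //= /setUidPl.
- by rewrite setUid.
Qed.

Lemma support_mono x y : (x <= y)%O -> support x \subset support y.
Proof. by move=> /join_r <-; rewrite support_join subsetUl. Qed.

Lemma new_le x k : base \subset support x -> inr k \in support x ->
  (new <= x)%O.
Proof.
case: x => [X|//] /= bX kX; rewrite /Order.le /= properE bX.
by apply/subsetPn; exists (inr k) => //; apply/imsetP => -[].
Qed.

Lemma new_le_support x : (new <= x)%O -> base \subset support x.
Proof. by move/support_mono. Qed.

(** Two elements of the Boolean lattice have a join above p only if it strictly contains a, hence
    contains some b_k. *)
Lemma new_le_join x y : (new <= Order.join x y)%O ->
  [\/ (new <= x)%O, (new <= y)%O | exists k, inr k \in support (Order.join x y)].
Proof.
case: x y => [X|] [Y|] h; [|by apply: Or32|by apply: Or31|by apply: Or31].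
apply: Or33; move: h => /properP[_ [[i|k] kXY nk]]; last by exists k.
by case/negP: nk; apply: imset_f.
Qed.

(** The halves of a: each is an atom or empty, and [part 0] and [part 1] cover a because m is at
    most 2. *)
Definition part (c : nat) : {set 'I_m + 'I_n} :=
  [set a : 'I_m + 'I_n | if a is inl i then i == c :> nat else false].

Lemma card_part c : #|part c| <= 1.
Proof.
apply/card_le1_eqP => -[i|k] [i'|k']; rewrite !inE //.
by move=> /eqP e /eqP e'; congr inl; apply: val_inj; rewrite /= e.
Qed.

Lemma part_mem (i : 'I_m) : inl i \in part 0 :|: part 1.
Proof. by rewrite !inE; have := ltn_ord i; lia. Qed.

Lemma partU : part 0 :|: part 1 = base.
Proof.
apply/setP=> -[i|k]; last by rewrite !inE; apply/esym/imsetP => -[].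
by rewrite part_mem imset_f.
Qed.

Lemma subset_part c i (X : {set 'I_m + 'I_n}) :
  inl i \in part c -> (part c \subset X) = (inl i \in X).
Proof.
move=> ic; have -> : part c = [set inl i]; last by rewrite sub1set.
apply/esym/eqP; rewrite eqEcard sub1set ic cards1; exact: card_part.
Qed.

(* The points are s_0 < ... < s_{n+1} < t_{n+1} < ... < t_0, where s_k and t_k
   carry the same label b_k for 0 < k, except that no label is attained at
   k = n+1, and s_0, t_0 carry the two halves of a.  The pair (u, v) enters at
   the join of the label of u, if u is some s_k, and of the label of v, if v is
   some t_k; the pair (s_0, t_0) enters at p. *)
Local Notation l := (n.+2).*2.

Definition color (u : nat) := if u < n.+2 then u else l - u.+1.

Lemma color_rev u v : u + v = l.-1 -> color u = color v.
Proof. by rewrite /color; case: (ltnP u n.+2); case: (ltnP v n.+2); lia. Qed.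

(** The shift [k.+1] leaves index 0 to the two ends. No [k] yields n+1, so the label of the two
    innermost points is always false. *)
Definition label x (u : nat) : bool :=
  if u == 0 then part 0 \subset support x
  else if u.+1 == l then part 1 \subset support x
  else [exists k : 'I_n, (k.+1 == color u) && (inr k \in support x)].

Lemma label_meet x y u : label (Order.meet x y) u = label x u && label y u.
Proof.
rewrite /label support_meet; case: ifP => _; [|case: ifP => _]; rewrite ?subsetI //.
apply/existsP/andP => [[k]|[/existsP[k /andP[ku kx]] /existsP[k']]].
  by rewrite inE => /and3P[ku kx ky]; split; apply/existsP; exists k; rewrite ku.
case/andP=> k'u k'y; exists k; rewrite ku inE kx /=.
suff -> : k = k' by [].
by apply: val_inj; move: ku k'u => /eqP <- /eqP[].
Qed.

Lemma label_join x y u : label (Order.join x y) u = label x u || label y u.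
Proof.
rewrite /label support_join; case: ifP => _; [|case: ifP => _];
  rewrite ?subsetU_small ?card_part //.
apply/existsP/orP => [[k]|[]/existsP[k /andP[ku kx]]].
- rewrite inE => /andP[ku /orP[] kx]; [left|right];
  by apply/existsP; exists k; rewrite ku.
- by exists k; rewrite ku inE kx.
- by exists k; rewrite ku inE kx orbT.
Qed.

Lemma label_color x u v : 0 < u -> u.+1 < l -> 0 < v -> v.+1 < l ->
  color u = color v -> label x u = label x v.
Proof.
move=> u0 ul v0 vl e; rewrite /label e.
by rewrite (gtn_eqF u0) (ltn_eqF ul) (gtn_eqF v0) (ltn_eqF vl).
Qed.

Lemma label_new x u : label x 0 -> label x l.-1 -> 0 < u -> u.+1 < l ->
  label x u -> (new <= x)%O.
Proof.
rewrite /label /= eqxx => p0 p1 u0 ul.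
rewrite (gtn_eqF u0) (ltn_eqF ul) => /existsP[k /andP[_ kx]].
by apply: new_le kx; rewrite -partU subUset p0.
Qed.

Lemma new_label x : (new <= x)%O -> label x 0 && label x l.-1.
Proof.
by move=> /new_le_support; rewrite -partU subUset /label /= eqxx.
Qed.

Definition emb x : {set 'I_l * 'I_l} :=
  [set p : 'I_l * 'I_l | (p.1 < p.2) &&
    if (p.1 == 0 :> nat) && (p.2.+1 == l) then (new <= x)%O
    else ((p.1 < n.+2) ==> label x p.1) && ((n.+2 <= p.2) ==> label x p.2)].

Lemma mem_emb x u v : ((u, v) \in emb x) = (u < v) &&
    if (u == 0 :> nat) && (v.+1 == l) then (new <= x)%O
    else ((u < n.+2) ==> label x u) && ((n.+2 <= v) ==> label x v).
Proof. by rewrite inE. Qed.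

Lemma mem_emb_label x u v : (u, v) \in emb x ->
  ((u < n.+2) ==> label x u) && ((n.+2 <= v) ==> label x v).
Proof.
rewrite mem_emb => /andP[uv]; case: ifP => // /andP[/eqP u0 /eqP vl].
move/new_label => /andP[h0 h1].
have v1 : v = l.-1 :> nat by rewrite -[LHS]succnK vl.
by rewrite u0 v1 h0 h1 !implybT.
Qed.

(** For transitivity, only a composite equal to (s_0, t_0) needs care: its middle point is labelled
    too, so [x] contains a and some b_k and lies above p. For the complement, a pair of [emb x] cut
    at v keeps its left part if v is some s_k and its right part if v is some t_k. *)
Lemma emb_clopen x : clopen_pairs (emb x).
Proof.
apply/and3P; split.
- by apply/subsetP=> -[u v]; rewrite mem_emb inE => /andP[].
- apply/closed_pairsP => v u w /= uv vw.
  have luv : u < v by move: uv; rewrite mem_emb => /andP[].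
  have lvw : v < w by move: vw; rewrite mem_emb => /andP[].
  have /andP[hu hv] := mem_emb_label uv; have /andP[hv' hw] := mem_emb_label vw.
  rewrite mem_emb (ltn_trans luv lvw) hu hw /=.
  case: ifP => // /andP[/eqP u0 /eqP wl].
  have wl' : w = l.-1 :> nat by rewrite -[LHS]succnK wl.
  apply: (@label_new x v); [| |lia|lia|].
  + by move: hu; rewrite u0.
  + by move: hw; rewrite wl' (_ : n.+2 <= l.-1); [|lia].
  + by case: (ltnP v n.+2) hv hv'.
apply/closed_pairsP => v u w; rewrite /= !in_setD ![in _ \in increasing_pairs _]inE /=.
move=> /andP[nuv uv] /andP[nvw vw]; rewrite (ltn_trans uv vw) andbT.
apply: contra nuv => uw; have /andP[hu hw] := mem_emb_label uw.
have wl := ltn_ord w.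
have nvl : (v.+1 == l) = false by apply/eqP; lia.
have nv0 : (v == 0 :> nat) = false by apply/eqP; lia.
case: (ltnP v n.+2) => hv.
  by rewrite mem_emb uv nvl andbF hu /= leqNgt hv.
by case/negP: nvw; rewrite mem_emb vw nv0 hw /= ltnNge hv.
Qed.

Definition emb_perm x : permutohedron l := Permutohedron (emb_clopen x).

Lemma emb_mono x y : (x <= y)%O -> emb x \subset emb y.
Proof.
move=> xy; have lab u : label x u -> label y u.
  by move: (label_join x y u); rewrite (join_r xy) => -> ->.
apply/subsetP=> -[u v]; rewrite !mem_emb => /andP[-> /=].
case: ifP => _; first by move/le_trans; apply.
by move=> /andP[/implyP hu /implyP hv]; apply/andP; split; apply/implyP; auto.
Qed.

Lemma emb_meet x y : emb x :&: emb y \subset emb (Order.meet x y).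
Proof.
apply/subsetP=> -[u v]; rewrite inE !mem_emb lexI !label_meet.
case: (u < v) => //=; case: ifP => _ //.
by do 2!case: (_ <= _) => //=; rewrite ?andbT //; do 4!case: (label _ _).
Qed.

(** Pairs among the s_k, pairs among the t_k and mirror pairs (s_k, t_k) with 0 < k depend on a
    single label, and labels respect joins. All other pairs are composed of these, except (s_0, t_0)
    when p is already below [x] or [y]. *)
Lemma emb_join x y u v : (u, v) \in emb (Order.join x y) ->
  connect (union_rel (emb x) (emb y)) u v.
Proof.
set J := Order.join x y; set C := connect _.
have edge (z : nat) (s t : 'I_l) : s < t ->
    ~~ ((s == 0 :> nat) && (t.+1 == l)) -> label J z ->
    (forall w, label w z ->
       ((s < n.+2) ==> label w s) && ((n.+2 <= t) ==> label w t)) -> C s t.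
  move=> st nends; rewrite label_join => Jz H.
  apply: connect1; rewrite /union_rel /= inE !mem_emb st (negPf nends) /=.
  by case/orP: Jz => /H ->; rewrite ?orbT.
have edgeS (s t : 'I_l) : s < t -> t < n.+2 -> label J s -> C s t.
  move=> st tn Js; apply: (edge s) => //; first by apply/negP; lia.
  by move=> w ->; rewrite implybT leqNgt tn.
have edgeT (s t : 'I_l) : s < t -> n.+2 <= s -> label J t -> C s t.
  move=> st sn Jt; apply: (edge t) => //; first by apply/negP; lia.
  by move=> w ->; rewrite implybT ltnNge sn.
have edgeST (s t : 'I_l) : 0 < s -> s < n.+2 -> s + t = l.-1 ->
    label J s -> C s t.
  move=> s0 sn st Js; apply: (edge s) => //; [lia|by apply/negP; lia|].
  move=> w ws; rewrite ws implybT (@label_color w t s) ?ws ?implybT //; try lia.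
  exact/esym/color_rev.
have labrev (s t : 'I_l) : 0 < s -> s.+1 < l -> s + t = l.-1 ->
    label J s = label J t.
  move=> s0 sl st; apply: label_color; try lia.
  exact: color_rev.
have lu := ltn_ord u; have lv := ltn_ord v.
rewrite mem_emb => /andP[uv]; case: ifP => [/andP[/eqP u0 /eqP vl] newJ|ends].
  have /andP[J0 J1] := new_label newJ.
  have [newx|newy|[k kJ]] := new_le_join newJ.
  - apply: connect1; rewrite /union_rel /= inE !mem_emb uv u0 vl !eqxx /=.
    by rewrite newx.
  - apply: connect1; rewrite /union_rel /= inE !mem_emb uv u0 vl !eqxx /=.
    by rewrite newy orbT.
  have lk := ltn_ord k.
  have ls : k.+1 < l by lia.
  (* This point carries the label of the atom [inr k]; the chain runs from s_0 to it, then to its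
     mirror image, then to t_0. *)
  pose s := Ordinal ls.
  have st : s + rev_ord s = l.-1 by rewrite /=; lia.
  have Js : label J s.
    rewrite /label /= (ltn_eqF (_ : k.+2 < l)); last lia.
    by apply/existsP; exists k; rewrite kJ /color ltnS ltnW ?eqxx.
  have sn : s < n.+2 by rewrite /=; lia.
  apply: (@connect_trans _ _ s).
    by apply: edgeS => //; rewrite u0.
  apply: (@connect_trans _ _ (rev_ord s)); first exact: edgeST.
  apply: edgeT; [rewrite /=; lia|rewrite /=; lia|].
  by have -> : v = l.-1 :> nat by lia.
move=> /andP[/implyP Ju /implyP Jv].
have [vn|nv] := ltnP v n.+2; first by apply: edgeS => //; apply: Ju; lia.
have [un|nu] := ltnP u n.+2; last by apply: edgeT => //; apply: Jv.
have {}Ju := Ju un; have {}Jv := Jv nv.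
have vr : v + rev_ord v = l.-1 by rewrite /=; lia.
have ur : u + rev_ord u = l.-1 by rewrite /=; lia.
(* For u = s_a and v = t_b this compares a with b: the chain passes through s_b if a < b and through
   t_a if b < a. *)
have [c|c|c] := ltngtP (u + v) l.-1.
- have v1 : v.+1 < l by lia.
  have rv : rev_ord v < n.+2 by rewrite /=; lia.
  have urv : u < rev_ord v by lia.
  apply: (@connect_trans _ _ (rev_ord v)); first exact: edgeS.
  by apply: edgeST => //; rewrite -?(labrev v) //; lia.
- have rv : n.+2 <= rev_ord u by rewrite /=; lia.
  have u0 : 0 < u by lia.
  apply: (@connect_trans _ _ (rev_ord u)); first exact: edgeST.
  by apply: edgeT => //; lia.
- apply: edgeST => //.
  rewrite lt0n; apply/negP => /eqP u0.
  by move: ends; rewrite u0 /= => /negP[]; apply/eqP; lia.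
Qed.

(** Adjacent points among the s_k, or among the t_k, form pairs that read off one label; the
    innermost points s_(n+1) and t_(n+1) supply the last neighbours. The pair (s_0, t_0) detects
    p. *)
Lemma emb_le x y : emb x \subset emb y -> (x <= y)%O.
Proof.
move=> /subsetP sub; have l2 : 1 < l by [].
pose s0 : 'I_l := Ordinal (ltnW l2).
have low (u : 'I_l) : u.+1 < n.+2 -> label x u -> label y u.
  move=> un xu; have u1l : u.+1 < l by lia.
  have nl : (u.+2 == l) = false by apply/eqP; lia.
  have /sub/mem_emb_label : (u, Ordinal u1l) \in emb x.
    by rewrite mem_emb /= nl andbF ltnSn xu implybT leqNgt un.
  by case/andP => /implyP -> //; lia.
have high (u : 'I_l) : n.+2 < u -> label x u -> label y u.
  move=> un xu; have u1l : u.-1 < l by have := ltn_ord u; lia.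
  have n0 : (u.-1 == 0) = false by apply/eqP; lia.
  have /sub/mem_emb_label : (Ordinal u1l, u) \in emb x.
    by rewrite mem_emb /= n0 xu implybT andbT; apply/andP; split; [|apply/implyP]; lia.
  by case/andP => _ /implyP -> //; lia.
case: x sub low high => [X|] sub low high; last first.
  have lastP : l.-1 < l by [].
  have /sub : (s0, Ordinal lastP) \in emb None by rewrite mem_emb /= eqxx.
  by rewrite mem_emb /= eqxx.
rewrite some_le; apply/subsetP=> -[i|k] aX.
  have := part_mem i; rewrite inE => /orP[] ip; rewrite -(subset_part _ ip).
    by apply: (low s0) => //; rewrite /label /= (subset_part _ ip).
  have lastP : l.-1 < l by [].
  have := high (Ordinal lastP); rewrite /label /= eqxx.
  by apply; [lia|rewrite (subset_part _ ip)].
have lk := ltn_ord k; have ls : k.+1 < l by lia.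
have nl : (k.+2 == l) = false by apply/eqP; lia.
have : label y (Ordinal ls).
  apply: low; first by rewrite /=; lia.
  rewrite /label /= nl; apply/existsP; exists k.
  by rewrite /= aX /color ltnS ltnW ?eqxx.
rewrite /label /= nl => /existsP[k' /andP[/eqP e]].
suff -> : k = k' by [].
by apply: val_inj; move: e; rewrite /color ltnS ltnW //= => -[].
Qed.

Lemma embedding : lattice_embeds L (permutohedron l).
Proof.
exists emb_perm; split.
- move=> x y [e]; apply/le_anti/andP.
  by split; apply: emb_le; rewrite e.
- move=> x y; apply/le_anti/andP; split.
    by rewrite lexI; apply/andP; split; apply: emb_mono; [exact: leIl|exact: leIr].
  apply: subset_trans (emb_meet x y); rewrite subsetI; apply/andP; split.
    exact: (@leIl _ _ (emb_perm x) (emb_perm y)).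
  exact: (@leIr _ _ (emb_perm y) (emb_perm x)).
- move=> x y; apply/le_anti/andP; split; last first.
    by rewrite leUx; apply/andP; split; apply: emb_mono; [exact: leUl|exact: leUr].
  apply/subsetP=> -[u v] uv; rewrite /= tclosureE (emb_join uv) andbT.
  by move: uv; rewrite mem_emb => /andP[].
Qed.

End Embedding.

(** * Duality between B(m,n) and B(n,m) *)

Definition swap_atom m n (a : 'I_m + 'I_n) : 'I_n + 'I_m :=
  match a with inl i => inr i | inr k => inl k end.

Lemma swap_atomK m n : cancel (@swap_atom m n) (@swap_atom n m).
Proof. by case. Qed.

(** The complement of a consists of the atoms b_j, which become the atoms a_j on the other side; so
    a is sent to a. *)
Definition dual_set m n (X : {set 'I_m + 'I_n}) : {set 'I_n + 'I_m} :=
  [set a | swap_atom a \notin X].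

Lemma dual_setK m n : cancel (@dual_set m n) (@dual_set n m).
Proof. by move=> X; apply/setP=> a; rewrite !inE swap_atomK negbK. Qed.

Lemma dual_set_base m n : dual_set (bool_a m n) = bool_a n m.
Proof.
apply/setP=> -[i|k]; rewrite !inE /=.
  by rewrite imset_f //; apply/imsetP => -[].
by rewrite imset_f //; apply/esym/imsetP => -[].
Qed.

Lemma dual_setS m n (X Y : {set 'I_m + 'I_n}) :
  (dual_set Y \subset dual_set X) = (X \subset Y).
Proof.
apply/subsetP/subsetP => h a.
  by have := h (swap_atom a); rewrite !inE swap_atomK; apply: contraTT.
by rewrite !inE; apply: contra; apply: h.
Qed.

(* The new element covers a, so the two are swapped. *)
Definition db_dual m n (x : doubled_bool m n) : doubled_bool n m :=
  if x is Some X then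
    if X == bool_a m n then None else Some (dual_set X)
  else Some (bool_a n m).

Lemma db_dualK m n : cancel (@db_dual m n) (@db_dual n m).
Proof.
case=> [X|] /=; last by rewrite eqxx.
case: eqP => [->//|nX] /=; rewrite -[bool_a n m]dual_set_base.
by rewrite (can_eq (@dual_setK m n)) (introF eqP nX) dual_setK.
Qed.

Lemma db_dual_le m n (x y : doubled_bool m n) :
  (x <= y)%O -> (db_dual y <= db_dual x)%O.
Proof.
rewrite /Order.le; case: x y => [X|] [Y|] //=.
- case: (eqVneq Y) => [->|nY]; case: (eqVneq X) => [->|nX] //= XY.
  + rewrite -(dual_set_base m n) properE !dual_setS XY.
    by apply: contra nX => h; rewrite eqEsubset XY.
  + by rewrite -(dual_set_base m n) dual_setS.
  + by rewrite dual_setS.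
- by case: eqP => //= _ XY; rewrite -(dual_set_base m n) dual_setS.
- case: (eqVneq Y) => [->|nY] /=; first by rewrite properxx.
  by move/proper_sub; rewrite -(dual_set_base m n) dual_setS.
Qed.

Section Antitone.
Variables (d d' : Order.disp_t) (L : latticeType d) (L' : latticeType d').
Variables (c : L -> L') (c' : L' -> L).
Hypotheses (cK : cancel c c') (c'K : cancel c' c).
Hypothesis c_anti : forall x y, (x <= y)%O -> (c y <= c x)%O.
Hypothesis c'_anti : forall x y, (x <= y)%O -> (c' y <= c' x)%O.

Lemma antitone_meet x y : c (Order.meet x y) = Order.join (c x) (c y).
Proof.
apply/le_anti/andP; split; last first.
  by rewrite leUx !c_anti ?leIl ?leIr.
rewrite -[leRHS]c'K; apply: c_anti; rewrite lexI -{2}[x]cK -{3}[y]cK.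
by rewrite !c'_anti ?leUl ?leUr.
Qed.

Lemma antitone_join x y : c (Order.join x y) = Order.meet (c x) (c y).
Proof.
apply/le_anti/andP; split; first by rewrite lexI !c_anti ?leUl ?leUr.
rewrite -[leLHS]c'K; apply: c_anti; rewrite leUx -{1}[x]cK -{2}[y]cK.
by rewrite !c'_anti ?leIl ?leIr.
Qed.

End Antitone.

(** Composing [f] with order-reversing bijections on both sides exchanges meets and joins twice. *)
Lemma embedding_dual m n l :
  lattice_embeds (doubled_bool m n) (permutohedron l) ->
  lattice_embeds (doubled_bool n m) (permutohedron l).
Proof.
case=> f [fI fM fJ].
have complK : cancel (@perm_compl l) (@perm_compl l) := @perm_complK l.
have compl_anti (u v : permutohedron l) :
    (u <= v)%O -> (perm_compl v <= perm_compl u)%O.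
  by move=> uv; rewrite /Order.le /= perm_le_compl.
have dualK p q := @db_dualK p q.
have dual_anti p q := @db_dual_le p q.
exists (fun x => perm_compl (f (db_dual x))); split.
- move=> x y /(can_inj complK)/fI; exact: (can_inj (dualK n m)).
- move=> x y.
  rewrite (antitone_meet (dualK n m) (dualK m n) (@dual_anti n m) (@dual_anti m n)).
  by rewrite fJ (antitone_join complK complK compl_anti compl_anti).
- move=> x y.
  rewrite (antitone_join (dualK n m) (dualK m n) (@dual_anti n m) (@dual_anti m n)).
  by rewrite fM (antitone_meet complK complK compl_anti compl_anti).
Qed.

Theorem theorem11p6 (m n : nat) :
  (exists2 l : nat, 0 < l & lattice_embeds (doubled_bool m n) (permutohedron l))
  <-> (m <= 2 \/ n <= 2).
Proof.
split=> [[l _ emb_mn]|[m2|n2]].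
- have [m2|m2] := leqP m 2; [by left|have [n2|n2] := leqP n 2; [by right|]].
  by case: (no_embedding m2 n2 emb_mn).
- by exists n.+2.*2; last exact: embedding.
by exists m.+2.*2; last exact/embedding_dual/embedding.
Qed.
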